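(* Let $p\in\mathbb N$. An element $f\in\Gamma(\mathcal H_{-p})$ is invertible (in the algebra $\widetilde{\mathcal S}_{-1}$ with the Wick product) if and only if $E[f]$ is invertible (in $\mathbb C$, i.e. $E[f]\ne0$).
   Context: $\mathbb N=\{1,2,\dots\}$. $\widetilde\ell$ is the free (non-commutative) monoid generated by symbols $z_1,z_2,\dots$, with identity the empty word. For $\alpha=z_{i_1}\cdots z_{i_m}\in\widetilde\ell$ put $(2\mathbb N)^\alpha=\prod_{k=1}^m(2i_k)$ (empty product $=1$) and $(2\mathbb N)^{\alpha s}=((2\mathbb N)^\alpha)^s$. For $p\in\mathbb Z$, $\Gamma(\mathcal H_p)$ denotes the Hilbert space of formal sums $f=\sum_{\alpha\in\widetilde\ell}f_\alpha e_\alpha$, $f_\alpha\in\mathbb C$, with squared norm $\sum_\alpha|f_\alpha|^2(2\mathbb N)^{\alpha p}<\infty$. $\widetilde{\mathcal S}_{-1}=\bigcup_{p\in\mathbb N}\Gamma(\mathcal H_{-p})$ is a unital $\mathbb C$-algebra under the Wick product $f\otimes g=\sum_{\gamma\in\widetilde\ell}\big(\sum_{\alpha\beta=\gamma}f_\alpha g_\beta\big)e_\gamma$, with unit $\mathbf 1=e_{\text{empty word}}$. The generalized expectation $E[f]\in\mathbb C$ of $f$ is its coefficient at the empty word. *)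

(* Defs.v *)
From HB Require Import structures.
From mathcomp Require Import all_boot all_order all_algebra.
From mathcomp Require Import all_classical all_reals ereal esum.
From mathcomp Require Import complex.

Set Implicit Arguments.
Unset Strict Implicit.
Unset Printing Implicit Defensive.
Import Order.TTheory GRing.Theory Num.Theory.
Local Open Scope classical_set_scope.
Local Open Scope ring_scope.
Local Open Scope complex_scope.

(* The letter z_i (i >= 1) is encoded by the natural number i - 1, so that the
   free monoid on z_1, z_2, ... is [seq nat] with concatenation, and z_i has
   weight 2 i = 2 * (i - 1).+1. *)
Definition word : Type := seq nat.

Definition wordweight (a : word) : nat := \prod_(i <- a) (2 * i.+1).

(* The formal sum of the f_a e_a is identified with its coefficients. *)
Definition formal_sum (R : realType) : Type := word -> R[i].

Definition Gamma_sqnorm (R : realType) (p : int) (f : formal_sum R) : \bar R :=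
  \esum_(a in [set: word])
    (Normc.normc (f a) ^+ 2 * (wordweight a)%:R ^ p)%:E.

Definition Gamma (R : realType) (p : int) : set (formal_sum R) :=
  [set f | (Gamma_sqnorm p f < +oo)%E].

Definition Sm1 (R : realType) : set (formal_sum R) :=
  \bigcup_(p in [set p : nat | (0 < p)%N]) Gamma (- p%:Z).

(* The sum ranges over a finite set of factorisations, see wickE. *)
Definition wick (R : realType) (f g : formal_sum R) : formal_sum R :=
  fun c => \sum_(ab \in [set ab : word * word | ab.1 ++ ab.2 = c])
             f ab.1 * g ab.2.

Definition wick1 (R : realType) : formal_sum R :=
  fun a => (a == [::])%:R.

Definition wick_invertible (R : realType) (f : formal_sum R) : Prop :=
  exists2 g, Sm1 g & wick f g = wick1 R /\ wick g f = wick1 R.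

Definition gen_expectation (R : realType) (f : formal_sum R) : R[i] := f [::].

Lemma wickE (R : realType) (f g : formal_sum R) (c : word) :
  wick f g c = \sum_(k < (size c).+1) f (take k c) * g (drop k c).
Proof.
pose h (k : nat) : word * word := (take k c, drop k c).
rewrite (fsbig_ord _ _ (fun k => f (take k c) * g (drop k c))) /wick.
apply: (reindex_fsbig h `I_(size c).+1 _ (fun ab => f ab.1 * g ab.2)).
split=> [k _|k l|[a b] /= abc]; first by rewrite /= cat_take_drop.
- rewrite !inE /= !ltnS => kc lc [+ _] => /(congr1 size).
  by rewrite !size_takel.
- exists (size a); first by rewrite /= -abc size_cat ltnS leq_addr.
  by rewrite /h -abc take_size_cat// drop_size_cat.
Qed.

(* Main.v *)
Require Import Defs.
From mathcomp Require Import all_boot all_order all_algebra.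
From mathcomp Require Import all_classical all_reals.
From mathcomp Require Import complex.
From mathcomp Require Import ereal esum ring lra.
Local Open Scope ring_scope.

(** Invertibility forces the constant coefficient to be invertible, because
    taking that coefficient turns the Wick product into the product of complex
    numbers.  Conversely, let [f [::]] be nonzero.

    Algebra.  Removing a fixed first letter [x] from all words is a linear map
    [lderiv x], which obeys the Leibniz-like rule [lderiv_wick].  Hence long
    division of any [phi] by [f] on the right proceeds letter by letter: the
    quotient has constant coefficient [q = phi [::] / f [::]], and its
    derivative along [x] is the quotient of [lderiv x phi - q * lderiv x f].
    Dividing the unit by [f] produces a left inverse [h] of [f].  As [h] has
    nonzero constant coefficient, it has a left inverse too, and associativity
    makes [h] two-sided.

    Analysis.  Membership in the union of the spaces is the same as a bound of
    the form [|f a| <= A * w(a) ^ m], where [w] is the multiplicative weight of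
    words ([Gamma_poly_bounded], [poly_bounded_Gamma]).  One direction holds
    since each term of a convergent positive sum is bounded, the other since
    the [w(a) ^ -2] are summable over all words: letter sums are at most [1/2],
    so words of length [n] contribute at most [2 ^ - n].  In the division, one
    step along [x] multiplies the size of the dividend by at most a constant
    [D] times the weight of [x] to the power [m]; so the quotient grows at most
    like [D ^ size a * w(a) ^ m], and the factor [D ^ size a] is absorbed in a
    power of [w(a)] because every letter has weight at least [2]. *)

Set Implicit Arguments.
Unset Strict Implicit.
Unset Printing Implicit Defensive.
Import Order.TTheory GRing.Theory Num.Theory.

(** * The Wick product and right division *)

Definition lderiv (R : realType) (x : nat) (f : formal_sum R) : formal_sum R :=
  fun a => f (x :: a).

Lemma wick_nil (R : realType) (f g : formal_sum R) :
  wick f g [::] = f [::] * g [::].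
Proof. by rewrite wickE big_ord1. Qed.

(** The factorisations of [x :: c] are the one with empty left factor and those
    whose left factor starts with [x]. *)
Lemma wick_cons (R : realType) (f g : formal_sum R) x c :
  wick f g (x :: c) = f [::] * g (x :: c) + wick (lderiv x f) g c.
Proof. by rewrite !wickE big_ord_recl. Qed.

Lemma lderiv_wick (R : realType) (f g : formal_sum R) x :
  lderiv x (wick f g) =
    fun c => f [::] * lderiv x g c + wick (lderiv x f) g c.
Proof. by apply/funext => c; rewrite /lderiv wick_cons. Qed.

Lemma wick_lin_l (R : realType) (u v g : formal_sum R) k c :
  wick (fun a => k * u a + v a) g c = k * wick u g c + wick v g c.
Proof.
rewrite !wickE mulr_sumr -big_split; apply: eq_bigr => i _ /=.
by rewrite mulrDl mulrA.
Qed.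

Lemma wickA (R : realType) (f g h : formal_sum R) :
  wick (wick f g) h = wick f (wick g h).
Proof.
apply/funext => c; elim: c f g h => [|x c IH] f g h.
  by rewrite !wick_nil mulrA.
rewrite [RHS]wick_cons -IH wick_cons wick_nil lderiv_wick wick_lin_l.
by rewrite wick_cons mulrDr mulrA addrA.
Qed.

Lemma wick1l (R : realType) (f : formal_sum R) : wick (wick1 R) f = f.
Proof.
apply/funext => c; rewrite wickE big_ord_recl take0 drop0 mul1r.
rewrite big1 ?addr0// => i _.
by case: c i => [[]//|x c] i /=; rewrite /wick1 mul0r.
Qed.

Lemma wick1r (R : realType) (f : formal_sum R) : wick f (wick1 R) = f.
Proof.
apply/funext => c; elim: c f => [|x c IH] f; first by rewrite wick_nil mulr1.
by rewrite wick_cons IH mulr0 add0r.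
Qed.

(** Right division of [phi] by [f], one letter at a time: comparing the terms
    starting with [x] in [wick q f = phi] gives
    [wick (lderiv x q) f = lderiv x phi - q [::] * lderiv x f]. *)
Fixpoint wick_div (R : realType) (f phi : formal_sum R) (c : word) : R[i] :=
  if c is x :: c'
  then wick_div f (fun a => lderiv x phi a - phi [::] / f [::] * lderiv x f a) c'
  else phi [::] / f [::].

Lemma wick_divK (R : realType) (f phi : formal_sum R) :
  f [::] != 0 -> wick (wick_div f phi) f = phi.
Proof.
move=> f0; apply/funext => c; elim: c phi => [|x c IH] phi.
  by rewrite wick_nil divfK.
by rewrite wick_cons IH /= addrC subrK.
Qed.

(** A left inverse has nonzero constant coefficient, hence a left inverse of its
    own, which can only be [f]. *)
Lemma wick_div1_inverse (R : realType) (f : formal_sum R) (f0 : f [::] != 0) :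
  let h := wick_div f (wick1 R) in wick f h = wick1 R /\ wick h f = wick1 R.
Proof.
move=> h; have hf : wick h f = wick1 R by exact: wick_divK.
have h0 : h [::] != 0 by rewrite /h /= mul1r invr_eq0.
have kh := wick_divK (wick1 R) h0; split=> //.
have <- : wick_div h (wick1 R) = f
  by rewrite -[RHS]wick1l -[in RHS]kh wickA hf wick1r.
exact: kh.
Qed.

(** * Weights of words *)

Lemma wordweight_nil : wordweight [::] = 1%N.
Proof. by rewrite /wordweight big_nil. Qed.

Lemma wordweight_cons x a : wordweight (x :: a) = (2 * x.+1 * wordweight a)%N.
Proof. by rewrite /wordweight big_cons. Qed.

Lemma wordweight_ge_expn a : (2 ^ size a <= wordweight a)%N.
Proof.
elim: a => [|x a IH]; first by rewrite wordweight_nil.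
by rewrite wordweight_cons expnS leq_mul// leq_pmulr.
Qed.

Lemma wordweight_gt0 a : (0 < wordweight a)%N.
Proof. exact: leq_trans (expn_gt0 2 (size a)) (wordweight_ge_expn a). Qed.

(** The words of length less than [L] on the first [N] letters.  These lists
    exhaust the words, and the sum of a multiplicative function over them obeys
    the recursion of a geometric series. *)
Fixpoint words (N L : nat) : seq word :=
  if L is L'.+1 then [::] :: [seq i :: w | i <- iota 0 N, w <- words N L']
  else [::].

Lemma mem_words N L (w : word) :
  (size w < L)%N -> all (fun i => i < N)%N w -> w \in words N L.
Proof.
elim: L w => [//|L IH] [//|x w] /= sw /andP[xN wN].
rewrite inE /=; apply/allpairsP; exists (x, w) => /=.
by split=> //; [rewrite mem_iota | exact: IH].
Qed.

Lemma words_exhaust (s : seq word) : exists N L, {subset s <= words N L}.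
Proof.
exists (\max_(w <- s) \max_(i <- w) i.+1), (\max_(w <- s) size w).+1 => w ws.
apply: mem_words; first by rewrite ltnS leq_bigmax_seq.
apply/allP => i iw.
apply: (@leq_trans (\max_(j <- w) j.+1)); first exact: leq_bigmax_seq.
exact: (@leq_bigmax_seq _ _ xpredT (fun v : word => \max_(j <- v) j.+1)%N).
Qed.

(** The subtracted term makes the sum telescope:
    [1 / (4 n + 2) - 1 / (4 n + 6) = 1 / (4 (n + 1) ^ 2 - 1)]. *)
Lemma letter_sum_le (R : realType) N :
  \sum_(i <- iota 0 N) ((2 * i.+1)%:R ^- 2 : R) <= 2^-1 - (4 * N + 2)%:R^-1.
Proof.
elim: N => [|N IH]; first by rewrite big_nil subrr.
rewrite -addn1 iotaD big_cat big_seq1 /= add0n.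
apply: le_trans (lerD IH (lexx _)) _.
rewrite -subr_ge0; set t : R := N%:R; have t0 : 0 <= t by rewrite /t.
have -> : (2 * N.+1)%:R = 2 * (t + 1) :> R by rewrite natrM -(addn1 N) natrD.
have -> : (4 * N + 2)%:R = 4 * t + 2 :> R by rewrite natrD natrM.
have -> : (4 * (N + 1) + 2)%:R = 4 * t + 6 :> R.
  by rewrite natrD natrM natrD -/t; ring.
clearbody t; rewrite (_ : _ - _ =
  (4 * (t + 1) ^+ 2 * (4 * (t + 1) ^+ 2 - 1))^-1).
  by rewrite invr_ge0; nra.
by field; apply/and4P; split; rewrite gt_eqF//; nra.
Qed.

Lemma words_sum_le (R : realType) N L :
  \sum_(w <- words N L) ((wordweight w)%:R ^- 2 : R) <= 2.
Proof.
elim: L => [|L IH]; first by rewrite big_nil.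
rewrite /= big_cons wordweight_nil expr1n invr1 big_allpairs_dep /=.
under eq_bigr => i _ do
  under eq_bigr => w _ do rewrite wordweight_cons natrM exprMn invfM.
under eq_bigr do rewrite -mulr_sumr.
rewrite -mulr_suml.
have sl : \sum_(i <- iota 0 N) ((2 * i.+1)%:R ^- 2 : R) <= 2^-1.
  by apply: le_trans (letter_sum_le R N) _; rewrite gerBl invr_ge0.
have sl0 : 0 <= \sum_(i <- iota 0 N) ((2 * i.+1)%:R ^- 2 : R).
  by apply: sumr_ge0 => i _; rewrite invr_ge0 exprn_ge0.
nra.
Qed.

Lemma ler_sum_uniq (R : realType) (T : eqType) (s t : seq T) (F : T -> R) :
  uniq s -> {subset s <= t} -> (forall x, 0 <= F x) ->
  \sum_(x <- s) F x <= \sum_(x <- t) F x.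
Proof.
move=> us st F0; elim: s t us st => [|x s IH] t /=.
  by rewrite big_nil sumr_ge0.
move=> /andP[xs us] st; have xt : x \in t by rewrite st ?mem_head.
rewrite big_cons (big_rem x xt) lerD2l IH// => y ys.
have := perm_mem (perm_to_rem xt) y; rewrite st ?inE ?ys ?orbT//.
by case: eqP => // yx; rewrite -yx ys in xs.
Qed.

Lemma esum_wordweight_le (R : realType) (K : R) : 0 <= K ->
  (\esum_(a in [set: word]) (K * (wordweight a)%:R ^- 2)%:E <= (K * 2)%:E)%E.
Proof.
move=> K0; apply: ge_ereal_sup => _ [X [finX _] <-].
rewrite fsumEFin// lee_fin fsbig_finite// -mulr_sumr ler_wpM2l//.
have [N [L sub]] := words_exhaust (finmap.enum_fset (fset_set X)).
apply: le_trans (words_sum_le R N L).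
by apply: ler_sum_uniq => // w; rewrite invr_ge0 exprn_ge0.
Qed.

(** * Polynomially bounded coefficients *)

Definition poly_bounded (R : realType) (m : nat) (A : R) (f : formal_sum R) :=
  forall a, Normc.normc (f a) <= A * (wordweight a)%:R ^+ m.

Lemma normc_ge0 (R : realType) (z : R[i]) : 0 <= Normc.normc z.
Proof. by case: z => a b; exact: sqrtr_ge0. Qed.

(** Each term of the sum defining the norm is at most the sum; the square root
    [sqrt w(a) ^ p] is replaced by the cruder [w(a) ^ p]. *)
Lemma Gamma_poly_bounded (R : realType) (p : nat) (f : formal_sum R) :
  Gamma (- p%:Z) f -> exists2 A : R, 0 <= A & poly_bounded p A f.
Proof.
rewrite /Gamma /= /Gamma_sqnorm; set S := esum _ _ => S_lty.
pose t a : R := Normc.normc (f a) ^+ 2 * (wordweight a)%:R ^ (- p%:Z).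
have t0 a : 0 <= t a by rewrite mulr_ge0 ?exprn_ge0 ?normc_ge0 ?exprz_ge0.
have S0 : (0 <= S)%E by apply: esum_ge0 => a _; rewrite lee_fin t0.
have tS a : t a <= fine S.
  rewrite -lee_fin fineK ?ge0_fin_numE//; apply: esum_ge.
  by exists [set a]%classic; [split | rewrite fsbig_set1].
(* The constant comes from [S * W <= ((1 + S) * W) ^ 2] for [W >= 1]. *)
exists (1 + fine S) => [|a]; first by rewrite addr_ge0 ?fine_ge0.
have w1 : 1 <= (wordweight a)%:R ^+ p :> R.
  by rewrite exprn_ege1// ler1n wordweight_gt0.
have := tS a; rewrite /t -exprnN ler_pdivrMr; last exact: lt_le_trans w1.
set n := Normc.normc _; set w := _ ^+ p in w1 * => nw.
have s0 : 0 <= fine S by rewrite fine_ge0.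
have n0 : 0 <= n by exact: normc_ge0.
rewrite -ler_sqr ?nnegrE ?mulr_ge0//; nra.
Qed.

(** The exponent [2 * m] cancels the growth of the squared coefficients, and the
    extra [2] leaves the summable weights [w(a) ^ -2]. *)
Lemma poly_bounded_Gamma (R : realType) (m : nat) (A : R) (f : formal_sum R) :
  poly_bounded m A f -> Gamma (- (2 * m + 2)%N%:Z) f.
Proof.
move=> bf; rewrite /Gamma /= /Gamma_sqnorm.
apply: le_lt_trans (ltry (A ^+ 2 * 2)).
apply: le_trans (esum_wordweight_le (sqr_ge0 A)).
apply: le_esum => a _; rewrite lee_fin -exprnN.
have w0 : 0 < (wordweight a)%:R :> R by rewrite ltr0n wordweight_gt0.
rewrite ler_pdivrMr ?exprn_gt0// exprD mulnC exprM -mulrA.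
rewrite [X in _ * X]mulrCA mulVf ?mulr1 ?expf_neq0 ?gt_eqF//.
by rewrite -exprMn lerXn2r ?nnegrE ?normc_ge0// (le_trans _ (bf a)) ?normc_ge0.
Qed.

(** One division step along [x] turns a dividend bounded by [M] into one
    bounded by [M * D * w(x) ^ m], with [D = 1 + A / |f [::]|]; these factors
    multiply up along the word [c]. *)
Lemma wick_div_bounded (R : realType) (m : nat) (A M : R) (f phi : formal_sum R) :
  0 <= A -> 0 <= M -> poly_bounded m A f -> poly_bounded m M phi ->
  forall c, Normc.normc (wick_div f phi c) <=
    M / Normc.normc (f [::]) * (1 + A / Normc.normc (f [::])) ^+ size c *
      (wordweight c)%:R ^+ m.
Proof.
move=> A0 M0 bf bphi c; set n0 := Normc.normc (f [::]).
have n00 : 0 <= n0 by exact: normc_ge0.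
have q_le (psi : formal_sum R) (B : R) : poly_bounded m B psi ->
    Normc.normc (psi [::] / f [::]) <= B / n0.
  move=> bpsi; rewrite Normc.normcM Normc.normcV ler_wpM2r ?invr_ge0//.
  by have := bpsi [::]; rewrite wordweight_nil expr1n mulr1.
elim: c phi M M0 bphi => [|x c IH] phi M M0 bphi.
  by rewrite wordweight_nil expr1n !mulr1; exact: q_le.
set wx : R := (2 * x.+1)%:R ^+ m.
have wx0 : 0 <= wx by rewrite exprn_ge0.
have := IH _ (M * (1 + A / n0) * wx) _ _.
rewrite wordweight_cons natrM exprMn exprS -/wx /=.
set W := _%:R ^+ m; set E := _ ^+ size c => IH'.
rewrite [leRHS](_ : _ = M * (1 + A / n0) * wx / n0 * E * W); last by ring.
apply: IH' => [|a].
  by rewrite !mulr_ge0// addr_ge0// divr_ge0.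
apply: le_trans (le_normcD _ _) _; rewrite normcN Normc.normcM.
have := bphi (x :: a); have := bf (x :: a); have := q_le _ _ bphi.
rewrite wordweight_cons natrM exprMn -/wx /lderiv => hq hf hphi.
rewrite [leRHS](_ : _ = M * (wx * (wordweight a)%:R ^+ m) +
  M / n0 * (A * (wx * (wordweight a)%:R ^+ m))); last by ring.
by rewrite lerD// ler_pM ?normc_ge0.
Qed.

Lemma wick_div1_Sm1 (R : realType) (m : nat) (A : R) (f : formal_sum R) :
  0 <= A -> poly_bounded m A f -> Sm1 (wick_div f (wick1 R)).
Proof.
move=> A0 bf; set n0 := Normc.normc (f [::]).
have n00 : 0 <= n0 by exact: normc_ge0.
have w1 (a : word) k : 1 <= (wordweight a)%:R ^+ k :> R.
  by rewrite exprn_ege1// ler1n wordweight_gt0.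
have b1 : poly_bounded m 1 (wick1 R).
  case=> [|x a]; rewrite mul1r /wick1 eqE.
    by rewrite Normc.normc1.
  by rewrite Normc.normc0 exprn_ge0.
pose q := Num.bound (1 + A / n0).
have D0 : 0 <= 1 + A / n0 by rewrite addr_ge0// divr_ge0.
have Dq : 1 + A / n0 <= 2 ^+ q.
  apply: le_trans (ltW (archi_boundP D0)) _.
  by rewrite -natrX ler_nat ltnW// ltn_expl.
exists (2 * (q + m) + 2)%N; first by rewrite /= addn2.
apply: (@poly_bounded_Gamma _ _ (1 / n0)) => c.
apply: le_trans (wick_div_bounded A0 ler01 bf b1 c) _.
rewrite exprD -mulrA ler_wpM2l ?divr_ge0// ler_wpM2r ?exprn_ge0//.
apply: (@le_trans _ _ ((2 ^+ q) ^+ size c)).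
  by rewrite lerXn2r ?nnegrE ?exprn_ge0.
rewrite exprAC lerXn2r ?nnegrE ?exprn_ge0//.
by rewrite -natrX ler_nat wordweight_ge_expn.
Qed.

Theorem proposition4p10 (R : realType) (p : nat) (hp : (0 < p)%N)
    (f : formal_sum R) (hf : Gamma (- p%:Z) f) :
  wick_invertible f <-> gen_expectation f \is a GRing.unit.
Proof.
rewrite unitfE /gen_expectation; split=> [[g _ [fg _]]|f0].
  apply/eqP => f0; have := congr1 (@^~ [::]) fg.
  by rewrite wick_nil f0 mul0r => /esym/eqP; rewrite oner_eq0.
have [A A0 bf] := Gamma_poly_bounded hf.
exists (wick_div f (wick1 R)); first exact: wick_div1_Sm1 bf.
exact: wick_div1_inverse.
Qed.
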